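(* Consider the L-SVRG iteration with $\psi\equiv 0$ (defined in the context) with stepsize $\eta>0$, probability $p\in(0,1]$ and sampling (or sampling with replacement) $S$. Let $f$ be $L_f$-smooth (possibly nonconvex) with $L_f>0$, and suppose there is a constant $\mathcal{L}_3>0$ such that for all $x,y\in\mathbb{R}^d$ $$\mathbb{E}\left[\left\|\tfrac1n(\mathbf{G}(x)-\mathbf{G}(y))\theta_S\mathbf{I}_Se-\tfrac1n(\mathbf{G}(x)-\mathbf{G}(y))e\right\|^2\right]\le\mathcal{L}_3\|x-y\|^2.$$ Let $x^a$ be chosen uniformly at random from $\{x^i\}_{i=0}^k$, and let $$\eta\le\bar\eta:=\min\left\{\frac{1}{4L_f},\ \frac{p^{2/3}}{36^{1/3}(L_f\mathcal{L}_3)^{1/3}},\ \frac{\sqrt p}{\sqrt{6\mathcal{L}_3}}\right\}.$$ Then $$\mathbb{E}[\|\nabla f(x^a)\|^2]\le\frac4\eta\cdot\frac{f(x^0)-f(x^* )}{k+1}.$$ If $\eta=\bar\eta$, then for $\epsilon>0$ one has $\mathbb{E}[\|\nabla f(x^a)\|^2]\le\epsilon$ as long as $$k\ge O\left(\left(L_f+\frac{(L_f\mathcal{L}_3)^{1/3}}{p^{2/3}}+\sqrt{\frac{\mathcal{L}_3}{p}}\right)\frac{f(x^0)-f(x^* )}{\epsilon}\right),$$ where $O(\cdot)$ hides an absolute constant.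
   Context: Problem: minimize $f=\frac1n\sum_{i=1}^nf_i$ over $\mathbb{R}^d$, where each $f_i:\mathbb{R}^d\to\mathbb{R}$ is differentiable; $f$ has at least one global minimizer, and $x^*$ denotes one. $f$ is $L_f$-smooth means $\nabla f$ is $L_f$-Lipschitz. Sampling: $[n]=\{1,\dots,n\}$ and $e\in\mathbb{R}^n$ is the all-ones vector. $S$ is one of the following. (a) A proper sampling: a random subset of $[n]$ with $\mathbb{P}[i\in S]>0$ for all $i$, together with real weights $\theta_C^i$ ($i\in[n]$, $C\subseteq[n]$). (b) A sampling with replacement: $S$ consists of $\tau$ independent copies of an index drawn from a distribution on $[n]$ with probabilities $\tilde p_i>0$ (repetitions counted), with weights $\theta_S^i=1/(\tau\tilde p_i)$. $\theta_S$ is the $n\times n$ diagonal matrix with diagonal entries $\theta_S^i$, and $\mathbf{I}_S$ is the diagonal matrix whose $i$-th diagonal entry is the number of copies of $i$ in $S$. It is assumed that $\mathbb{E}[\theta_S\mathbf{I}_S]e=e$ (automatic in case (b)). $\mathbf{G}(x)=[\nabla f_1(x),\dots,\nabla f_n(x)]\in\mathbb{R}^{d\times n}$, so $\frac1n\mathbf{G}(x)\theta_S\mathbf{I}_Se=\frac1n\sum_{i\in S}\theta_S^i\nabla f_i(x)$ with multiplicities. L-SVRG with $\psi\equiv0$: $x^0=w^0\in\mathbb{R}^d$. For $k=0,1,2,\dots$: draw $S_k$ as a fresh independent copy of $S$; set $g^k=\frac1n(\mathbf{G}(x^k)-\mathbf{G}(w^k))\theta_{S_k}\mathbf{I}_{S_k}e+\frac1n\mathbf{G}(w^k)e$;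 set $x^{k+1}=x^k-\eta g^k$; set $w^{k+1}=x^k$ with probability $p$ and $w^{k+1}=w^k$ with probability $1-p$ (by an independent coin flip). The index $a$ is uniform on $\{0,\dots,k\}$, independent of the algorithm. *)

(* Defs.v *)
From HB Require Import structures.
From mathcomp Require Import all_boot all_order all_algebra.
From mathcomp Require Import all_classical all_reals all_analysis.
Set Implicit Arguments.
Unset Strict Implicit.
Unset Printing Implicit Defensive.
Import Order.TTheory GRing.Theory Num.Theory.
Import numFieldNormedType.Exports.
Local Open Scope classical_set_scope.
Local Open Scope ring_scope.

(* The norm carried by 'cV[R]_d in the library is the sup norm; it is used only
   for the topology underlying [differentiable]. *)
Definition enorm (R : realType) (d : nat) (v : 'cV[R]_d) : R :=
  Num.sqrt (\sum_(j < d) v j 0 ^+ 2).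

Definition grad (R : realType) (d : nat) (f : 'cV[R]_d -> R) (x : 'cV[R]_d) :
    'cV[R]_d :=
  \col_(j < d) 'D_(delta_mx j 0) f x.

Definition smooth (R : realType) (d : nat) (L : R) (f : 'cV[R]_d -> R) : Prop :=
  forall x y : 'cV[R]_d, enorm (grad f x - grad f y) <= L * enorm (x - y).

Definition average (R : realType) (d n : nat) (f : 'I_n -> 'cV[R]_d -> R) :
    'cV[R]_d -> R :=
  fun x => n%:R^-1 * \sum_(i < n) f i x.

Definition ones (R : realType) (n : nat) : 'cV[R]_n := const_mx 1.

Definition Gmat (R : realType) (d n : nat) (f : 'I_n -> 'cV[R]_d -> R)
    (x : 'cV[R]_d) : 'M[R]_(d, n) :=
  \matrix_(j < d, i < n) grad (f i) x j 0.

(* [Subset q theta]: a random subset of [n] with law q, and theta C i the weight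
   of i when the set C is drawn.
   [Replacement tau pt]: tau independent indices, each with law pt. *)
Inductive sampling (R : realType) (n : nat) : Type :=
| Subset of ({set 'I_n} -> R) & ({set 'I_n} -> 'I_n -> R)
| Replacement of nat & ('I_n -> R).

Definition outcome (R : realType) (n : nat) (s : sampling R n) : finType :=
  match s with
  | Subset _ _ => {set 'I_n}
  | Replacement tau _ => tau.-tuple 'I_n
  end.

Definition outcome_law (R : realType) (n : nat) (s : sampling R n) : outcome s -> R :=
  match s return outcome s -> R with
  | Subset q _ => q
  | Replacement tau pt => fun t => \prod_(j < tau) pt (tnth t j)
  end.

Definition weight (R : realType) (n : nat) (s : sampling R n) :
    outcome s -> 'I_n -> R :=
  match s return outcome s -> 'I_n -> R with
  | Subset _ theta => theta
  | Replacement tau pt => fun _ i => (tau%:R * pt i)^-1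
  end.

Definition copies (R : realType) (n : nat) (s : sampling R n) :
    outcome s -> 'I_n -> nat :=
  match s return outcome s -> 'I_n -> nat with
  | Subset _ _ => fun C i => (i \in C : nat)
  | Replacement _ _ => fun t i => count_mem i t
  end.

Definition valid_sampling (R : realType) (n : nat) (s : sampling R n) : Prop :=
  match s with
  | Subset q _ =>
      [/\ forall C, 0 <= q C, \sum_C q C = 1
        & forall i : 'I_n, 0 < \sum_(C : {set 'I_n} | i \in C) q C]
  | Replacement tau pt =>
      [/\ (0 < tau)%N, forall i, 0 < pt i & \sum_i pt i = 1]
  end.

Definition theta_mx (R : realType) (n : nat) (s : sampling R n) (c : outcome s) :
    'M[R]_n :=
  diag_mx (\row_(i < n) weight c i).

Definition I_mx (R : realType) (n : nat) (s : sampling R n) (c : outcome s) :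
    'M[R]_n :=
  diag_mx (\row_(i < n) (copies c i)%:R).

(* E[F(S)], as S takes finitely many values. *)
Definition sampling_mean (R : realType) (n : nat) (s : sampling R n)
    (V : lmodType R) (F : outcome s -> V) : V :=
  \sum_(c : outcome s) outcome_law c *: F c.

Definition unbiased (R : realType) (n : nat) (s : sampling R n) : Prop :=
  sampling_mean (fun c : outcome s => theta_mx c *m I_mx c) *m ones R n
  = ones R n.

Definition variance_bound (R : realType) (d n : nat)
    (f : 'I_n -> 'cV[R]_d -> R) (s : sampling R n) (L3 : R) : Prop :=
  forall x y : 'cV[R]_d,
    sampling_mean (V := R^o) (fun c : outcome s =>
      enorm (n%:R^-1 *: ((Gmat f x - Gmat f y) *m theta_mx c *m I_mx c *m ones R n)
             - n%:R^-1 *: ((Gmat f x - Gmat f y) *m ones R n)) ^+ 2)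
    <= L3 * enorm (x - y) ^+ 2.

Definition lsvrg_dir (R : realType) (d n : nat) (f : 'I_n -> 'cV[R]_d -> R)
    (s : sampling R n) (c : outcome s) (x w : 'cV[R]_d) : 'cV[R]_d :=
  n%:R^-1 *: ((Gmat f x - Gmat f w) *m theta_mx c *m I_mx c *m ones R n)
  + n%:R^-1 *: (Gmat f w *m ones R n).

(* The pair (x^k, w^k) for given realizations C of the samples and B of the
   coins; B j = true means that w^(j+1) is refreshed to x^j. *)
Fixpoint lsvrg (R : realType) (d n : nat) (f : 'I_n -> 'cV[R]_d -> R)
    (s : sampling R n) (eta : R) (x0 : 'cV[R]_d)
    (C : nat -> outcome s) (B : nat -> bool) (k : nat) : 'cV[R]_d * 'cV[R]_d :=
  match k with
  | 0%N => (x0, x0)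
  | j.+1 =>
      let: (x, w) := lsvrg f eta x0 C B j in
      (x - eta *: lsvrg_dir f (C j) x w, if B j then x else w)
  end.

Definition has_pmf (R : realType) (dT : measure_display) (T : measurableType dT)
    (P : probability T R) (U : finType) (X : T -> U) (mu : U -> R) : Prop :=
  forall u : U,
    measurable (X @^-1` [set u]) /\ P (X @^-1` [set u]) = (mu u)%:E.

(* All subsets of the codomain are used: it is meant for X with values in a
   finite discrete space. *)
Definition sigma_of (T U : Type) (X : T -> U) : set_system T :=
  preimage_set_system setT X setT.

Definition mutually_independent (R : realType) (dT : measure_display)
    (T : measurableType dT) (P : probability T R) (I : choiceType)
    (E : I -> set_system T) : Prop :=
  forall (J : seq I) (A : I -> set T), uniq J ->
    (forall i, i \in J -> E i (A i)) ->
    P (\bigcap_(i in [set` J]) A i) = (\prod_(i <- J) fine (P (A i)))%:E.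

(* Some (inl j) indexes the sample S_j, Some (inr j) the coin of step j, and
   None the index a. *)
Definition sources (T U K : Type) (S : nat -> T -> U) (B : nat -> T -> bool)
    (a : T -> K) (i : option (nat + nat)) : set_system T :=
  match i with
  | Some (inl j) => sigma_of (S j)
  | Some (inr j) => sigma_of (B j)
  | None => sigma_of a
  end.

Definition lsvrg_randomness (R : realType) (n : nat) (s : sampling R n) (p : R)
    (dT : measure_display) (T : measurableType dT) (P : probability T R)
    (S : nat -> T -> outcome s) (B : nat -> T -> bool)
    (k : nat) (a : T -> 'I_k.+1) : Prop :=
  [/\ forall j, has_pmf P (S j) (@outcome_law R n s),
      forall j, has_pmf P (B j) (fun b : bool => if b then p else 1 - p),
      has_pmf P a (fun=> k.+1%:R^-1)
    & mutually_independent P (sources S B a)].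

Definition eta_bar (R : realType) (Lf L3 p : R) : R :=
  Num.min (1 / (4 * Lf))
    (Num.min (p `^ (2 / 3) / (36 `^ (1 / 3) * (Lf * L3) `^ (1 / 3)))
             (Num.sqrt p / Num.sqrt (6 * L3))).

(* Main.v *)
Require Import Defs.
From mathcomp Require Import all_boot all_order all_algebra.
From mathcomp Require Import all_classical all_reals all_analysis.
From mathcomp Require Import measurable_realfun.
From mathcomp Require Import ring lra.
Import Order.TTheory GRing.Theory Num.Theory.
Import numFieldNormedType.Exports.
Local Open Scope classical_set_scope.
Local Open Scope ring_scope.

(** The argument is a Lyapunov analysis.  Write F for the average of the f_i,
    x and w for the iterate and the reference point, and g for the direction
    used from (x, w).  Unbiasedness of the sampling gives E g = grad F x
    ([lsvrg_dir_mean]), and the variance hypothesis gives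
    E |g|^2 <= |grad F x|^2 + L3 |x - w|^2 ([lsvrg_dir_sqr_mean]).  Together
    with the quadratic upper bound implied by smoothness ([descent]), they show
    that the potential F x + c |x - w|^2, for the weight
    c = 3 Lf eta^2 L3 / (2 p), decreases on average by at least
    (eta / 4) |grad F x|^2 in one iteration ([lyapunov_decrease]): the
    refreshes of w contract |x - w|^2 by a factor of about 1 - p / 2, which
    pays both for the variance of g and for the displacement of x.  The error
    terms are the quadratic term of the descent bound, the displacement of x
    and the variance of g inside |x - w|^2; each is controlled by one term of
    the minimum defining the largest stepsize ([eta_bar_bounds],
    [lyapunov_scalar]).

    Since x^0 = w^0, the potential starts at F x^0, and it stays above
    F xstar.  Summing the decrease over the iterations ([lyapunov_sum]) bounds
    the sum of the expected squared gradients by (4 / eta) (F x^0 - F xstar).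

    All expectations are computed by iterating the one-step averaging operator
    [mean_step].  The link with the probability space is [integral_chain]: on
    an event built from sources not used before time m, the integral of a
    function of the state at time m is the m-fold average of that function
    times the probability of the event.  Applied to the event that the random
    index equals i, it turns the risk into the uniform average of the first
    k + 1 expected squared gradients.  The complexity bound follows because the
    inverse of the largest stepsize is at most four times the sum in
    parentheses ([inv_eta_bar_le]). *)

(** * The Euclidean inner product *)

(** The inner product whose norm is [enorm]. *)
Definition dot {R : realType} {d : nat} (u v : 'cV[R]_d) : R :=
  \sum_(j < d) u j 0 * v j 0.

Lemma enorm_sqr {R : realType} {d : nat} (v : 'cV[R]_d) :
  enorm v ^+ 2 = dot v v.
Proof. by rewrite sqr_sqrtr //; apply: sumr_ge0 => j _; exact: sqr_ge0. Qed.

Lemma dotC {R : realType} {d : nat} (u v : 'cV[R]_d) : dot u v = dot v u.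
Proof. by apply: eq_bigr => j _; rewrite mulrC. Qed.

Lemma dotDl {R : realType} {d : nat} (u v w : 'cV[R]_d) :
  dot (u + v) w = dot u w + dot v w.
Proof. by rewrite -big_split; apply: eq_bigr => j _; rewrite mxE mulrDl. Qed.

Lemma dotZl {R : realType} {d : nat} (t : R) (u w : 'cV[R]_d) :
  dot (t *: u) w = t * dot u w.
Proof. by rewrite mulr_sumr; apply: eq_bigr => j _; rewrite mxE mulrA. Qed.

Lemma dotNl {R : realType} {d : nat} (u w : 'cV[R]_d) :
  dot (- u) w = - dot u w.
Proof. by rewrite -scaleN1r dotZl mulN1r. Qed.

Lemma dotDr {R : realType} {d : nat} (u v w : 'cV[R]_d) :
  dot u (v + w) = dot u v + dot u w.
Proof. by rewrite !(dotC u) dotDl. Qed.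

Lemma dotZr {R : realType} {d : nat} (t : R) (u w : 'cV[R]_d) :
  dot u (t *: w) = t * dot u w.
Proof. by rewrite !(dotC u) dotZl. Qed.

Lemma dotNr {R : realType} {d : nat} (u w : 'cV[R]_d) :
  dot u (- w) = - dot u w.
Proof. by rewrite !(dotC u) dotNl. Qed.

Definition dotE := (@dotDl, @dotDr, @dotNl, @dotNr, @dotZl, @dotZr).

Lemma dot_sumr {R : realType} {d : nat} (I : finType) (u : 'cV[R]_d)
    (w : I -> R) (F : I -> 'cV[R]_d) :
  dot u (\sum_c w c *: F c) = \sum_c w c * dot u (F c).
Proof.
pose D v := dot u v.
have DD : {morph D : x y / x + y} by move=> x y; rewrite /D dotDr.
have D0 : D 0 = 0 by rewrite /D -(scale0r 0) dotZr mul0r.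
rewrite -/(D _) (big_morph D DD D0); apply: eq_bigr => c _.
by rewrite /D dotZr.
Qed.

Lemma dot_ge0 {R : realType} {d : nat} (v : 'cV[R]_d) : 0 <= dot v v.
Proof. by apply: sumr_ge0 => j _; rewrite -expr2 sqr_ge0. Qed.

(** Young's inequality; it replaces the Cauchy-Schwarz inequality throughout. *)
Lemma dot_young {R : realType} {d : nat} (t : R) (u v : 'cV[R]_d) :
  0 < t -> 2 * dot u v <= t * dot v v + t^-1 * dot u u.
Proof.
move=> t0; have := dot_ge0 (t *: v - u); rewrite !dotE (dotC v u).
rewrite -(pmulr_rge0 _ (_ : 0 < t^-1)) ?invr_gt0 // => h.
rewrite -subr_ge0; apply: le_trans h _; rewrite le_eqVlt; apply/orP; left.
by apply/eqP; field; rewrite gt_eqF.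
Qed.

(** * Gradients and the descent lemma *)

Lemma derive_grad {R : realType} {d : nat} {f : 'cV[R]_d -> R}
    (x v : 'cV[R]_d) :
  differentiable f x -> 'D_v f x = dot (grad f x) v.
Proof.
move=> df; rewrite deriveE //.
have -> : v = \sum_(j < d) v j 0 *: delta_mx j 0.
  apply/colP => i; rewrite summxE (bigD1 i) //= big1 ?addr0 => [|j ji].
    by rewrite !mxE !eqxx mulr1.
  by rewrite !mxE eq_sym (negbTE ji) mulr0.
rewrite linear_sum dot_sumr; apply: eq_bigr => j _.
rewrite linearZ /=; congr (_ * _).
rewrite -deriveE // /dot (bigD1 j) //= big1 => [|i ij]; rewrite !mxE.
  by rewrite !eqxx mulr1 addr0.
by rewrite (negbTE ij) mulr0.
Qed.

Lemma is_derive_line {R : realType} {d : nat} {f : 'cV[R]_d -> R}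
    (x v : 'cV[R]_d) t :
  differentiable f (x + t *: v) ->
  is_derive t 1 (fun s : R => f (x + s *: v)) (dot (grad f (x + t *: v)) v).
Proof.
move=> df; rewrite -derive_grad //.
have dv := @diff_derivable _ _ _ f _ v df.
have E : (fun h : R => h^-1 *:
      (((fun s : R => f (x + s *: v)) \o shift t) (h *: (1:R)) - f (x + t *: v)))
  = (fun h : R => h^-1 *:
      ((f \o shift (x + t *: v)) (h *: v) - f (x + t *: v))).
  apply/funext => h /=; congr (_ *: (f _ - _)).
  by rewrite [h *: 1]mulr1 scalerDl addrCA addrA.
by split; rewrite /derivable /derive E.
Qed.

(** The quadratic upper bound for a function with Lipschitz gradient.  The
    function t |-> f (x + t v) - t <grad f x, v> - t^2 (L / 2) |v|^2 has a
    nonpositive derivative on ]0, 1[. *)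
Lemma descent {R : realType} {d : nat} (f : 'cV[R]_d -> R) (L : R)
    (x v : 'cV[R]_d) :
  0 < L -> (forall y, differentiable f y) -> smooth L f ->
  f (x + v) <= f x + dot (grad f x) v + L / 2 * dot v v.
Proof.
move=> L0 df sf.
pose a := dot (grad f x) v; pose b := L / 2 * dot v v.
pose phi (t : R) := f (x + t *: v) - (t * a + t ^+ 2 * b).
have dphi (t : R) :
    is_derive t 1 phi (dot (grad f (x + t *: v)) v - (a + (2 * t) * b)).
  apply: is_deriveB; first exact: is_derive_line.
  apply: is_deriveD.
    have -> : (fun s : R => s * a) = a \*: id.
      by apply/funext => s; rewrite /= mulrC.
    apply: is_derive_eq; by rewrite [_ *: _]mulr1.
  have -> : (fun s : R => s ^+ 2 * b) = b \*: (fun s : R => s ^+ 2).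
    by apply/funext => s; rewrite /= mulrC.
  by apply: is_derive_eq; rewrite /GRing.scale /=; ring.
have le0 (t : R) : t \in `]0, 1[%R -> derive1 phi t <= 0.
  rewrite in_itv/= => /andP[t0 _]; rewrite derive1E derive_val.
  rewrite opprD addrA -[a]/(dot _ v) -dotNl -dotDl subr_le0 /b.
  have h := sf (x + t *: v) x; set g := _ - _ in h.
  have -> : grad f (x + t *: v) + - grad f x = g by [].
  (* The parameter L t makes both terms of Young's bound equal L t |v|^2. *)
  have young := dot_young _ g v (mulr_gt0 L0 t0).
  have h2 : dot g g <= (L * t) ^+ 2 * dot v v.
    rewrite -enorm_sqr; apply: (@le_trans _ _ ((L * enorm (t *: v)) ^+ 2)).
      have := h; rewrite addrAC subrr add0r => h'.
      by rewrite lerXn2r // nnegrE ?sqrtr_ge0 // (le_trans _ h') ?sqrtr_ge0.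
    rewrite exprMn enorm_sqr !dotE le_eqVlt; apply/orP; left.
    by apply/eqP; ring.
  have := ler_wpM2l (_ : 0 <= (L * t)^-1) h2.
  rewrite invr_ge0 => /(_ (ltW (mulr_gt0 L0 t0))).
  have -> : (L * t)^-1 * ((L * t) ^+ 2 * dot v v) = L * t * dot v v.
    by field; rewrite !gt_eqF.
  move=> h3; lra.
have exphi t : derivable phi t 1 by exact: (ex_derive (is_derive := dphi t)).
have := @ler0_derive1_nincr R phi 0 1 (fun t _ => exphi t) le0 _
  0 1 (lexx 0) ler01 (lexx 1).
rewrite /phi scale1r scale0r addr0 !mul0r expr0n /= mul0r !addr0 subr0 mul1r.
rewrite expr1n mul1r lerBlDr addrA; apply.
by apply: derivable_within_continuous => t _; exact: exphi.
Qed.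

Lemma differentiable_average {R : realType} {d n : nat}
    {f : 'I_n -> 'cV[R]_d -> R} x :
  (forall i, differentiable (f i) x) -> differentiable (average f) x.
Proof.
move=> df.
have -> : average f = n%:R^-1 *: (\sum_(i < n) f i).
  by apply/funext => y; rewrite /average fctE /= fct_sumE.
by apply: differentiableZ; apply: differentiable_sum.
Qed.

Lemma grad_average {R : realType} {d n : nat} {f : 'I_n -> 'cV[R]_d -> R} x :
  (forall i, differentiable (f i) x) ->
  grad (average f) x = n%:R^-1 *: (Gmat f x *m ones R n).
Proof.
move=> df; have dv i v : derivable (f i) x v := diff_derivable (df i).
have -> : average f = n%:R^-1 \*: (\sum_(i < n) f i).
  by apply/funext => y; rewrite /average /= fct_sumE.
apply/colP => j; rewrite !mxE deriveZ; last exact: derivable_sum.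
rewrite derive_sum //; congr (_ * _).
by apply: eq_bigr => i _; rewrite !mxE mulr1.
Qed.

(** * Chains driven by independent finite noise *)

(** The state at time m of the recursion s_(j+1) = step (C j) (B j) s_j. *)
Fixpoint chain {X U : Type} (step : U -> bool -> X -> X) (s0 : X)
    (C : nat -> U) (B : nat -> bool) (m : nat) : X :=
  if m is j.+1 then step (C j) (B j) (chain step s0 C B j) else s0.

(** The averaging operator of one step: it sends V to the function whose value
    at s is the mean of V at the next state, the noise and the coin being
    independent with weights [law] and [coin]. *)
Definition mean_step {R : realType} {X : Type} {U : finType}
    (step : U -> bool -> X -> X) (law : U -> R) (coin : bool -> R)
    (V : X -> R) : X -> R :=
  fun s => \sum_(u : U * bool) law u.1 * coin u.2 * V (step u.1 u.2 s).

Lemma mean_stepE {R : realType} {X : Type} {U : finType}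
    (step : U -> bool -> X -> X) (law : U -> R) (coin : bool -> R)
    (V : X -> R) (s : X) :
  mean_step step law coin V s
  = \sum_(u : U * bool) law u.1 * coin u.2 * V (step u.1 u.2 s).
Proof. by []. Qed.

Lemma iter_mean_step_sum {R : realType} {X : Type} {U I : finType}
    (step : U -> bool -> X -> X) (law : U -> R) (coin : bool -> R)
    (w : I -> R) (F : I -> X -> R) (m : nat) (s : X) :
  iter m (mean_step step law coin) (fun s' => \sum_i w i * F i s') s
  = \sum_i w i * iter m (mean_step step law coin) (F i) s.
Proof.
elim: m s => [//|m IH] s; rewrite /= [LHS]mean_stepE.
under [LHS]eq_bigr => u _ do rewrite IH mulr_sumr.
rewrite exchange_big /=; apply: eq_bigr => i _.
by rewrite mulr_sumr; apply: eq_bigr => u _; rewrite mulrCA.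
Qed.

Lemma iter_mean_step_le {R : realType} {X : Type} {U : finType}
    (step : U -> bool -> X -> X) (law : U -> R) (coin : bool -> R)
    (V W : X -> R) (m : nat) (s : X) :
  (forall u, 0 <= law u) -> (forall b, 0 <= coin b) ->
  (forall s', V s' <= W s') ->
  iter m (mean_step step law coin) V s <= iter m (mean_step step law coin) W s.
Proof.
move=> l0 c0 VW; elim: m s => [//|m IH] s /=; rewrite !mean_stepE.
by apply: ler_sum => u _; rewrite ler_wpM2l ?mulr_ge0 // IH.
Qed.

(** The source i is not used to compute the state at time m; the index of the
    random iterate, None, never is. *)
Definition not_before (m : nat) (i : option (nat + nat)) : bool :=
  match i with
  | Some (inl j) | Some (inr j) => (m <= j)%N
  | None => true
  end.

Lemma sigma_of_preimage {T U : Type} (X : T -> U) (D : set U) :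
  sigma_of X (X @^-1` D).
Proof.
by rewrite /sigma_of /preimage_set_system /=; exists D; rewrite ?setTI.
Qed.

(** The value at w of the measurable function selected by Z w is measurable in w. *)
Lemma measurable_fun_fiber {R : realType} {dT : measure_display}
    {T : measurableType dT} {I : finType} (Z : T -> I) (F : I -> T -> R) :
  (forall i, measurable (Z @^-1` [set i])) ->
  (forall i, measurable_fun setT (F i)) ->
  measurable_fun setT (fun w => F (Z w) w).
Proof.
move=> mZ mF.
have -> : (fun w => F (Z w) w) =
    fun w => \sum_i F i w * \1_(Z @^-1` [set i]) w.
  apply/funext => w; rewrite (bigD1 (Z w)) //= big1 => [|i /eqP ne].
    by rewrite indicE mem_set // mulr1 addr0.
  by rewrite indicE memNset ?mulr0 // => /esym.
by apply: measurable_sum => i; apply: measurable_funM.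
Qed.

(** The integral of such a selection splits along the values of Z. *)
Lemma ge0_integral_fiber {R : realType} {dT : measure_display}
    {T : measurableType dT} {P : probability T R} {I : finType}
    (D : set T) (Z : T -> I) (F : I -> T -> R) :
  measurable D -> (forall i, measurable (Z @^-1` [set i])) ->
  (forall i, measurable_fun setT (F i)) -> (forall i w, 0 <= F i w) ->
  (\int[P]_(w in D) (F (Z w) w)%:E
   = \sum_i \int[P]_(w in D `&` Z @^-1` [set i]) (F i w)%:E)%E.
Proof.
move=> mD mZ mF F0.
have DE : D = \big[setU/set0]_(i <- enum I) (D `&` Z @^-1` [set i]).
  rewrite -bigcup_seq; apply/seteqP; split=> w /=.
    by move=> Dw; exists (Z w); rewrite /= ?mem_enum.
  by case=> i _ [].
rewrite [in LHS]DE ge0_integral_bigsetU //.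
- rewrite big_enum; apply: eq_bigr => i _; apply: eq_integral => w.
  by rewrite inE => -[_ /= ->].
- by move=> i; apply: measurableI.
- exact: enum_uniq.
- by move=> i j _ _ [w [[_ /= <-] [_ /= <-]]].
- apply/measurable_EFinP.
  by apply: measurable_funS (measurable_fun_fiber _ _ mZ mF).
- by move=> w _; rewrite lee_fin.
Qed.

Lemma has_pmf_sum {R : realType} {dT : measure_display}
    {T : measurableType dT} {P : probability T R} {U : finType}
    {X : T -> U} {mu : U -> R} :
  has_pmf P X mu -> \sum_u mu u = 1.
Proof.
move=> pX; apply: EFin_inj; rewrite -(@probability_setT _ _ _ P) -sumEFin.
have := @ge0_integral_fiber R dT T P U setT X (fun _ _ => 1) measurableT
   (fun u => (pX u).1).
rewrite integral_cst // mul1e => -> //; apply: eq_bigr => u _.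
by have [mX pXu] := pX u; rewrite setTI integral_cst // mul1e; exact: esym pXu.
Qed.

Lemma has_pmf_ge0 {R : realType} {dT : measure_display}
    {T : measurableType dT} {P : probability T R} {U : finType}
    {X : T -> U} {mu : U -> R} :
  has_pmf P X mu -> forall u, 0 <= mu u.
Proof. by move=> pX u; rewrite -lee_fin -(pX u).2. Qed.

Lemma measurable_pair_fiber {dT : measure_display} {T : measurableType dT}
    {U V : Type} (Y : T -> U) (Z : T -> V) (u : U * V) :
  measurable (Y @^-1` [set u.1]) -> measurable (Z @^-1` [set u.2]) ->
  measurable ((fun w => (Y w, Z w)) @^-1` [set u]).
Proof.
case: u => u v mY mZ; rewrite [X in measurable X](_ : _ =
  Y @^-1` [set u] `&` Z @^-1` [set v]); first exact: measurableI.
by apply/seteqP; split=> w /=; [case|case] => -> ->.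
Qed.

Lemma measurable_chain {R : realType} {dT : measure_display}
    {T : measurableType dT} {X : Type} {U : finType}
    (step : U -> bool -> X -> X) (s0 : X)
    (S : nat -> T -> U) (B : nat -> T -> bool) (V : X -> R) (m : nat) :
  (forall j u, measurable (S j @^-1` [set u])) ->
  (forall j b, measurable (B j @^-1` [set b])) ->
  measurable_fun setT (fun w => V (chain step s0 (S^~ w) (B^~ w) m)).
Proof.
move=> mS mB; elim: m V => [|m IH] V; first exact: (measurable_cst (V s0)).
apply: (measurable_fun_fiber (fun w => (S m w, B m w))
  (fun u w => V (step u.1 u.2 (chain step s0 (S^~ w) (B^~ w) m)))) => u.
  exact: measurable_pair_fiber.
exact: (IH (fun s => V (step u.1 u.2 s))).
Qed.

(** The Markov property in integrated form.  The induction on m generalizes the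
    event: splitting according to the values of the noise at time m adds the
    two sources of that time to J, and they are not used before time m. *)
Lemma integral_chain {R : realType} {dT : measure_display}
    {T : measurableType dT} {P : probability T R} {X : Type} {U : finType}
    {K : Type} (step : U -> bool -> X -> X) (s0 : X)
    (law : U -> R) (coin : bool -> R)
    (S : nat -> T -> U) (B : nat -> T -> bool) (a : T -> K) :
  (forall j, has_pmf P (S j) law) -> (forall j, has_pmf P (B j) coin) ->
  mutually_independent P (sources S B a) ->
  forall (m : nat) (V : X -> R) (J : seq (option (nat + nat)))
    (A : option (nat + nat) -> set T),
  (forall s, 0 <= V s) -> uniq J -> all (not_before m) J ->
  (forall i, i \in J -> sources S B a i (A i)) ->
  measurable (\bigcap_(i in [set` J]) A i) ->
  (\int[P]_(w in \bigcap_(i in [set` J]) A i)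
      (V (chain step s0 (S^~ w) (B^~ w) m))%:E)%E
  = (iter m (mean_step step law coin) V s0
     * \prod_(i <- J) fine (P (A i)))%:E.
Proof.
move=> pS pB ind; elim=> [|m IH] V J A V0 uJ lJ sJ mD.
  by rewrite /= integral_cst // EFinM; congr (_ * _)%E; exact: ind.
set D := \bigcap_(i in _) _ in mD *.
have mS j u : measurable (S j @^-1` [set u]) by have [] := pS j u.
have mB j b : measurable (B j @^-1` [set b]) by have [] := pB j b.
pose W (u : U * bool) s := V (step u.1 u.2 s).
pose Z w := (S m w, B m w).
rewrite (ge0_integral_fiber D Z
  (fun u w => W u (chain step s0 (S^~ w) (B^~ w) m))) //; last 3 first.
- by move=> u; exact: measurable_pair_fiber.
- by move=> u; exact: measurable_chain.
- by move=> u w; exact: V0.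
have notin j : (j < m.+1)%N -> Some (inl j) \notin J /\ Some (inr j) \notin J.
  by move=> jm; split; apply/negP => /(allP lJ) /=; rewrite leqNgt jm.
have [nl nr] := notin m (ltnSn m).
have FE (u : U * bool) :
    (\int[P]_(w in D `&` Z @^-1` [set u])
        (W u (chain step s0 (S^~ w) (B^~ w) m))%:E
   = (law u.1 * coin u.2 * iter m (mean_step step law coin) (W u) s0
     * \prod_(i <- J) fine (P (A i)))%:E)%E.
  pose A' i := if i == Some (inl m) then S m @^-1` [set u.1] else
               if i == Some (inr m) then B m @^-1` [set u.2] else A i.
  pose J' := Some (inl m) :: Some (inr m) :: J.
  have A'J i : i \in J -> A' i = A i.
    by move=> iJ; rewrite /A' !ifN //;
      [apply: contraNneq nr | apply: contraNneq nl] => <-.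
  have FJ : D `&` Z @^-1` [set u] = \bigcap_(i in [set` J']) A' i.
    rewrite /J' bigcap_seq !big_cons -bigcap_seq setIC setIA.
    congr (_ `&` _); last by apply: eq_bigcapr => i /= iJ; rewrite A'J.
    rewrite /A' /= !eqxx; apply/seteqP.
    split=> w /=; first by move=> <-.
    by case=> Su Bu; rewrite /Z Su Bu -surjective_pairing.
  rewrite FJ (IH (W u) J' A').
  - rewrite /J' !big_cons /A' /= !eqxx /=.
    have -> : \prod_(j <- J) fine (P (A' j)) = \prod_(j <- J) fine (P (A j)).
      by apply: eq_big_seq => i iJ; rewrite A'J.
    by rewrite (pS m u.1).2 (pB m u.2).2 /=; congr EFin; ring.
  - by move=> s; exact: V0.
  - by rewrite /= inE negb_or nl nr uJ.
  - rewrite /= leqnn /=; apply: sub_all lJ => -[[j|j]|] //=; exact: ltnW.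
  - move=> i; rewrite !inE => /or3P[/eqP->|/eqP->|iJ].
    + by rewrite /A' eqxx; exact: sigma_of_preimage.
    + by rewrite /A' /= eqxx; exact: sigma_of_preimage.
    + by rewrite A'J //; exact: sJ.
  - by rewrite -FJ; apply: measurableI => //; exact: measurable_pair_fiber.
rewrite (eq_bigr _ (fun u _ => FE u)) sumEFin -mulr_suml iterSr.
by rewrite (iter_mean_step_sum step law coin (fun u => law u.1 * coin u.2) W).
Qed.

(** * Averages along a chain *)

Lemma iter_mean_stepD {R : realType} {X : Type} {U : finType}
    (step : U -> bool -> X -> X) (law : U -> R) (coin : bool -> R)
    (V W : X -> R) (t : R) (m : nat) (s : X) :
  iter m (mean_step step law coin) (fun s' => V s' + t * W s') s
  = iter m (mean_step step law coin) V s
    + t * iter m (mean_step step law coin) W s.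
Proof.
have := iter_mean_step_sum step law coin (fun b : bool => if b then t else 1)
  (fun b => if b then W else V) m s.
rewrite big_bool /= mul1r addrC => <-; congr (iter m _ _ s).
by apply/funext => s'; rewrite big_bool /= mul1r addrC.
Qed.

Lemma iter_mean_step_cst {R : realType} {X : Type} {U : finType}
    (step : U -> bool -> X -> X) (law : U -> R) (coin : bool -> R)
    (t : R) (m : nat) (s : X) :
  \sum_u law u = 1 -> \sum_b coin b = 1 ->
  iter m (mean_step step law coin) (fun _ => t) s = t.
Proof.
move=> l1 c1; elim: m s => [//|m IH] s /=; rewrite mean_stepE.
under eq_bigr => u _ do rewrite IH.
rewrite -mulr_suml -(pair_bigA _ (fun c b => law c * coin b)) /=.
under eq_bigr => u _ do rewrite -mulr_sumr c1 mulr1.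
by rewrite l1 mul1r.
Qed.

(** If the potential Psi decreases on average by at least t N in each step and
    is bounded below by M, summing the decreases telescopes. *)
Lemma lyapunov_sum {R : realType} {X : Type} {U : finType}
    (step : U -> bool -> X -> X) (law : U -> R) (coin : bool -> R)
    (Psi N : X -> R) (t M : R) (s0 : X) (k : nat) :
  (forall u, 0 <= law u) -> (forall b, 0 <= coin b) ->
  \sum_u law u = 1 -> \sum_b coin b = 1 ->
  (forall s, mean_step step law coin Psi s <= Psi s - t * N s) ->
  (forall s, M <= Psi s) ->
  t * \sum_(i < k) iter i (mean_step step law coin) N s0 <= Psi s0 - M.
Proof.
move=> l0 c0 l1 c1 dec MPsi.
suff : t * \sum_(i < k) iter i (mean_step step law coin) N s0
    <= Psi s0 - iter k (mean_step step law coin) Psi s0.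
  move/le_trans; apply; rewrite lerD2l lerN2.
  rewrite -[leLHS](iter_mean_step_cst step law coin M k s0) //.
  exact: iter_mean_step_le.
elim: k => [|k IH]; first by rewrite big_ord0 mulr0 subrr.
rewrite big_ord_recr /= mulrDr -iterS iterSr.
have : iter k (mean_step step law coin) (mean_step step law coin Psi) s0 <=
   iter k (mean_step step law coin) Psi s0
   - t * iter k (mean_step step law coin) N s0.
  rewrite -mulNr -iter_mean_stepD; apply: iter_mean_step_le => // s.
  by rewrite mulNr.
by move: IH; lra.
Qed.

(** * One iteration of L-SVRG *)

(** One L-SVRG iteration on pairs (iterate, reference point), for the sample c
    and the coin b. *)
Definition lsvrg_step {R : realType} {d n : nat} (f : 'I_n -> 'cV[R]_d -> R)
    (s : sampling R n) (eta : R) (c : outcome s) (b : bool)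
    (xw : 'cV[R]_d * 'cV[R]_d) : 'cV[R]_d * 'cV[R]_d :=
  (xw.1 - eta *: lsvrg_dir f c xw.1 xw.2, if b then xw.1 else xw.2).

Lemma lsvrg_chain {R : realType} {d n : nat} (f : 'I_n -> 'cV[R]_d -> R)
    (s : sampling R n) (eta : R) (x0 : 'cV[R]_d)
    (C : nat -> outcome s) (B : nat -> bool) (k : nat) :
  lsvrg f eta x0 C B k = chain (lsvrg_step f s eta) (x0, x0) C B k.
Proof. by elim: k => [//|k IH] /=; rewrite -IH; case: lsvrg. Qed.

Lemma lsvrg_dir_mean {R : realType} {d n : nat} {f : 'I_n -> 'cV[R]_d -> R}
    {s : sampling R n} (x w : 'cV[R]_d) :
  (forall i y, differentiable (f i) y) ->
  \sum_c @outcome_law R n s c = 1 -> unbiased s ->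
  \sum_c @outcome_law R n s c *: lsvrg_dir f (s := s) c x w
  = grad (average f) x.
Proof.
move=> df l1 unb.
rewrite grad_average //.
under eq_bigr => c _ do rewrite scalerDr scalerA mulrC -scalerA.
rewrite big_split /= -scaler_suml l1 scale1r -scaler_sumr -scalerDr.
congr (_ *: _).
transitivity ((Gmat f x - Gmat f w) *m
   (sampling_mean (fun c : outcome s => theta_mx c *m I_mx c) *m ones R n)
   + Gmat f w *m ones R n).
  congr (_ + _); rewrite /sampling_mean mulmx_suml mulmx_sumr.
  by apply: eq_bigr => c _; rewrite -scalemxAl -scalemxAr !mulmxA.
by rewrite unb mulmxBl subrK.
Qed.

(** The second moment is the squared mean plus the variance. *)
Lemma mean_sqr {R : realType} {d : nat} {I : finType} (law : I -> R)
    (g : I -> 'cV[R]_d) (m : 'cV[R]_d) :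
  \sum_c law c = 1 -> \sum_c law c *: g c = m ->
  \sum_c law c * dot (g c) (g c)
  = dot m m + \sum_c law c * enorm (g c - m) ^+ 2.
Proof.
move=> l1 gm.
have : dot m m = \sum_c law c * dot m (g c) by rewrite -dot_sumr gm.
have E c : law c * enorm (g c - m) ^+ 2 =
   law c * dot (g c) (g c) - 2 * (law c * dot m (g c)) + law c * dot m m.
  by rewrite enorm_sqr !dotE (dotC (g c) m); ring.
rewrite (eq_bigr _ (fun c _ => E c)) !big_split /= -mulr_suml l1 sumrN.
rewrite -mulr_sumr.
by move=> <-; ring.
Qed.

Lemma lsvrg_dir_sqr_mean {R : realType} {d n : nat} {f : 'I_n -> 'cV[R]_d -> R}
    {s : sampling R n} (L3 : R) (x w : 'cV[R]_d) :
  (forall i y, differentiable (f i) y) ->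
  \sum_c @outcome_law R n s c = 1 -> unbiased s -> variance_bound f s L3 ->
  \sum_c @outcome_law R n s c
      * dot (lsvrg_dir f (s := s) c x w) (lsvrg_dir f c x w)
  <= dot (grad (average f) x) (grad (average f) x) + L3 * dot (x - w) (x - w).
Proof.
move=> df l1 unb var.
rewrite (mean_sqr _ _ _ l1 (lsvrg_dir_mean x w df l1 unb)).
rewrite lerD2l -enorm_sqr; apply: le_trans (var x w).
rewrite /sampling_mean le_eqVlt; apply/orP; left; apply/eqP.
apply: eq_bigr => c _; congr (_ * enorm _ ^+ 2).
rewrite grad_average // /lsvrg_dir (mulmxBl (Gmat f x) _ (ones R n)).
by rewrite [in RHS]scalerBr opprB addrA.
Qed.

(** The weight c of |x - w|^2 in the Lyapunov function.  It satisfies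
    c p / 3 = (Lf / 2) eta^2 L3: the part p / 3 of the contraction of |x - w|^2
    absorbs the variance in the quadratic term of the descent lemma. *)
Definition lyap_weight {R : realType} (Lf L3 p eta : R) : R :=
  3 * Lf * eta ^+ 2 * L3 / (2 * p).

(** The real inequality behind the one-step decrease, where D, N and q stand for
    |x - w|^2, |grad F x|^2 and - 2 eta <x - w, grad F x>.  It is linear in D
    and N once q is bounded by Young's inequality, so only the signs of the two
    coefficients matter. *)
Lemma lyapunov_scalar {R : realType} (Lf L3 p eta D N q : R) :
  let c := lyap_weight Lf L3 p eta in
  0 < Lf -> 0 < L3 -> 0 < p <= 1 -> 0 < eta -> 0 <= D -> 0 <= N ->
  eta * Lf <= 1 / 4 -> 36 * (Lf * L3) * eta ^+ 3 <= p ^+ 2 ->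
  6 * L3 * eta ^+ 2 <= p ->
  q <= p / 2 * D + 2 / p * eta ^+ 2 * N ->
  (1 - p) * c * D - eta * N + (1 - p) * c * q
    + (Lf / 2 + c) * eta ^+ 2 * (N + L3 * D)
  <= c * D - eta / 4 * N.
Proof.
move=> c L0 L30 /andP[p0 p1] eta0 D0 N0 h1 h2 h3 hq.
have c0 : 0 <= c.
  by rewrite divr_ge0 ?mulr_ge0 ?sqr_ge0 // ltW.
have cp : c * p = 3 / 2 * (Lf * eta ^+ 2 * L3).
  by rewrite /c /lyap_weight; field; rewrite gt_eqF.
have ce : c * eta ^+ 2 * (2 / p) <= eta / 12.
  have -> : c * eta ^+ 2 * (2 / p)
      = 36 * (Lf * L3) * eta ^+ 3 * (eta / 12 / p ^+ 2).
    by rewrite /c /lyap_weight; field; rewrite gt_eqF.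
  apply: le_trans (ler_wpM2r _ h2) _.
    by rewrite !divr_ge0 // ?sqr_ge0 // ltW.
  by rewrite mulrC divfK // gt_eqF // exprn_gt0.
have q1 : (1 - p) * c * q <= (1 - p) * c * (p / 2 * D + 2 / p * eta ^+ 2 * N).
  by apply: ler_wpM2l => //; rewrite mulr_ge0 // subr_ge0.
have coefD : 0 <= c - (1 - p) * c - (1 - p) * c * (p / 2)
    - (Lf / 2 + c) * eta ^+ 2 * L3.
  have -> : c - (1 - p) * c - (1 - p) * c * (p / 2)
      - (Lf / 2 + c) * eta ^+ 2 * L3
     = c * (p / 6 - L3 * eta ^+ 2 + p ^+ 2 / 2)
       + (c * p - 3 / 2 * (Lf * eta ^+ 2 * L3)) / 3 by field.
  rewrite cp subrr mul0r addr0 mulr_ge0 // addr_ge0 ?divr_ge0 ?sqr_ge0 //.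
  by move: h3; lra.
have coefN : 0 <= eta * (3 / 4) - c * eta ^+ 2 * (2 / p)
    + 2 * (c * eta ^+ 2) - (Lf / 2 + c) * eta ^+ 2.
  have ee : Lf * eta ^+ 2 <= eta / 4.
    by have := ler_wpM2l (ltW eta0) h1; lra.
  have cee : 0 <= c * eta ^+ 2 by rewrite mulr_ge0 ?sqr_ge0.
  by move: ee cee ce; lra.
have := mulr_ge0 coefD D0; have := mulr_ge0 coefN N0.
have E : (1 - p) * c * (p / 2 * D + 2 / p * eta ^+ 2 * N) =
  (1 - p) * c * (p / 2) * D + (c * eta ^+ 2 * (2 / p) - 2 * (c * eta ^+ 2)) * N.
  by field; rewrite gt_eqF.
by move: q1; rewrite E; lra.
Qed.

(** The Lyapunov function F x + c |x - w|^2. *)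
Definition lyapunov {R : realType} {d n : nat} (f : 'I_n -> 'cV[R]_d -> R)
    (c : R) (xw : 'cV[R]_d * 'cV[R]_d) : R :=
  average f xw.1 + c * dot (xw.1 - xw.2) (xw.1 - xw.2).

Lemma lyapunov_decrease {R : realType} {d n : nat} {f : 'I_n -> 'cV[R]_d -> R}
    {s : sampling R n} {Lf L3 p eta : R} (xw : 'cV[R]_d * 'cV[R]_d) :
  (forall i y, differentiable (f i) y) ->
  (forall c, 0 <= @outcome_law R n s c) ->
  \sum_c @outcome_law R n s c = 1 -> unbiased s ->
  0 < Lf -> smooth Lf (average f) -> 0 < L3 -> variance_bound f s L3 ->
  0 < p <= 1 -> 0 < eta ->
  eta * Lf <= 1 / 4 -> 36 * (Lf * L3) * eta ^+ 3 <= p ^+ 2 ->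
  6 * L3 * eta ^+ 2 <= p ->
  mean_step (lsvrg_step f s eta) (@outcome_law R n s)
      (fun b : bool => if b then p else 1 - p)
      (lyapunov f (lyap_weight Lf L3 p eta)) xw
  <= lyapunov f (lyap_weight Lf L3 p eta) xw
     - eta / 4 * enorm (grad (average f) xw.1) ^+ 2.
Proof.
move=> df l0 l1 unb L0 sm L30 var p01 eta0 h1 h2 h3.
have /andP[p0 p1] := p01.
(* The names c and u are opaque, so that expanding inner products and
   normalizing polynomials treat them as atoms. *)
have [c cE] : {c | c = lyap_weight Lf L3 p eta}.
  by exists (lyap_weight Lf L3 p eta).
rewrite -cE; case: xw => x w; rewrite /lyapunov /=.
set g := grad _ _; have [u uE] : {u | u = x - w} by exists (x - w).
rewrite -uE; set F := average f.
pose dir e := lsvrg_dir f (s := s) e x w.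
have c0 : 0 <= c.
  by rewrite cE divr_ge0 ?mulr_ge0 ?sqr_ge0 // ltW.
have dF y : differentiable F y by exact: differentiable_average.
rewrite mean_stepE -(pair_bigA _ (fun e b =>
  outcome_law e * (if b then p else 1 - p)
  * lyapunov f c (lsvrg_step f s eta e b (x, w)))) /=.
pose h := g + (2 * (1 - p) * c) *: u.
(* The bound for a fixed sample averages the coin exactly; its mean over the
   sample then only involves the first two moments of the direction. *)
apply: (@le_trans _ _ (\sum_e @outcome_law R n s e *
  ((F x + (1 - p) * c * dot u u) - eta * dot h (dir e)
    + (Lf / 2 + c) * eta ^+ 2 * dot (dir e) (dir e)))).
  apply: ler_sum => e _; rewrite big_bool /= -!mulrA -mulrDr ler_wpM2l //.
  rewrite /lyapunov /lsvrg_step /= -/F -/(dir e).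
  have dsc := descent F Lf x (- (eta *: dir e)) L0 dF sm.
  have -> : x - eta *: dir e - x = - (eta *: dir e).
    by rewrite addrAC subrr add0r.
  have -> : x - eta *: dir e - w = u - eta *: dir e by rewrite uE addrAC.
  move: dsc; move: (dir e) => v; rewrite /h !dotE -/g -/F (dotC v u).
  by lra.
have -> : \sum_e @outcome_law R n s e *
  ((F x + (1 - p) * c * dot u u) - eta * dot h (dir e)
    + (Lf / 2 + c) * eta ^+ 2 * dot (dir e) (dir e))
  = (F x + (1 - p) * c * dot u u) - eta * dot h g
    + (Lf / 2 + c) * eta ^+ 2
      * \sum_e @outcome_law R n s e * dot (dir e) (dir e).
  have gE : \sum_e @outcome_law R n s e *: dir e = g by exact: lsvrg_dir_mean.
  under eq_bigr => e _ do rewrite mulrDr mulrBr.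
  rewrite !big_split /= sumrN -mulr_suml l1 mul1r -gE dot_sumr !mulr_sumr.
  by congr (_ - _ + _); apply: eq_bigr => e _; rewrite mulrCA.
have sq := lsvrg_dir_sqr_mean L3 x w df l1 unb var.
rewrite -/g -uE in sq.
have k0 : 0 <= (Lf / 2 + c) * eta ^+ 2.
  by rewrite mulr_ge0 ?sqr_ge0 // addr_ge0 // divr_ge0 // ltW.
have sq' := ler_wpM2l k0 sq.
(* With the parameter p / 2 a contraction remains, as
   (1 - p) (1 + p / 2) <= 1 - p / 2. *)
have yq : - (2 * eta * dot u g) <= p / 2 * dot u u + 2 / p * eta ^+ 2 * dot g g.
  have := dot_young (p / 2) (- (eta *: g)) u (divr_gt0 p0 (ltr0Sn _ 1)).
  rewrite !dotE invf_div (dotC g u) => y.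
  by move: y; lra.
have := lyapunov_scalar Lf L3 p eta _ _ _ L0 L30 p01 eta0 (dot_ge0 u) (dot_ge0 g)
  h1 h2 h3 yq.
rewrite -cE enorm_sqr /h !dotE; move: sq'; rewrite /dir.
by lra.
Qed.

(** * The stepsize *)

Lemma powR_third_cube {R : realType} (x : R) :
  0 <= x -> (x `^ (1 / 3)) ^+ 3 = x.
Proof.
by move=> x0; rewrite -powR_mulrn ?powR_ge0 // -powRrM divfK ?powRr1 //.
Qed.

Lemma powR_two_thirds_cube {R : realType} (x : R) :
  0 <= x -> (x `^ (2 / 3)) ^+ 3 = x ^+ 2.
Proof.
by move=> x0; rewrite -powR_mulrn ?powR_ge0 // -powRrM divfK ?powR_mulrn //.
Qed.

(** The three conditions on the stepsize, with roots cleared. *)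
Lemma eta_bar_bounds {R : realType} {Lf L3 p eta : R} :
  0 < Lf -> 0 < L3 -> 0 < p -> 0 < eta -> eta <= eta_bar Lf L3 p ->
  [/\ eta * Lf <= 1 / 4, 36 * (Lf * L3) * eta ^+ 3 <= p ^+ 2
    & 6 * L3 * eta ^+ 2 <= p].
Proof.
move=> L0 L30 p0 eta0; rewrite /eta_bar !le_min => /and3P[h1 h2 h3]; split.
- by move: h1; rewrite ler_pdivlMr ?mulr_gt0 //; lra.
- have LL0 : 0 < Lf * L3 by rewrite mulr_gt0.
  move: h2; rewrite ler_pdivlMr ?mulr_gt0 ?powR_gt0 // => h2.
  have lhs0 : 0 <= eta * (36 `^ (1 / 3) * (Lf * L3) `^ (1 / 3)).
    by rewrite !mulr_ge0 ?powR_ge0 // ltW.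
  have := lerXn2r 3 lhs0 (powR_ge0 p (2 / 3)) h2.
  rewrite /= !exprMn (powR_third_cube (Lf * L3) (ltW LL0)).
  by rewrite (powR_third_cube 36) // (powR_two_thirds_cube p (ltW p0)); lra.
- move: h3; rewrite ler_pdivlMr ?sqrtr_gt0 ?mulr_gt0 // => h3.
  have lhs0 : 0 <= eta * Num.sqrt (6 * L3).
    by rewrite mulr_ge0 ?sqrtr_ge0 // ltW.
  have := lerXn2r 2 lhs0 (sqrtr_ge0 p) h3.
  by rewrite /= exprMn !sqr_sqrtr ?mulr_ge0 // ?(ltW p0) ?(ltW L30) //; lra.
Qed.

(** The factor 4 comes from the first term of the minimum; it also bounds the
    cube root of 36 and the square root of 6. *)
Lemma inv_eta_bar_le {R : realType} {Lf L3 p : R} :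
  0 < Lf -> 0 < L3 -> 0 < p ->
  (eta_bar Lf L3 p)^-1 <=
  4 * (Lf + (Lf * L3) `^ (1 / 3) / p `^ (2 / 3) + Num.sqrt (L3 / p)).
Proof.
move=> L0 L30 p0.
have LL0 : 0 < Lf * L3 by rewrite mulr_gt0.
set b := _ / p `^ _; set c := Num.sqrt (L3 / p).
have b0 : 0 <= b by rewrite divr_ge0 ?powR_ge0.
have c0 : 0 <= c by exact: sqrtr_ge0.
have root36 : 36 `^ (1 / 3) <= 4 :> R.
  rewrite -(ler_pXn2r (ltn0Sn 2)) ?nnegrE ?powR_ge0 // powR_third_cube //.
  by lra.
have root6 : Num.sqrt 6 <= 4 :> R.
  by rewrite -(ler_pXn2r (ltn0Sn 1)) ?nnegrE ?sqrtr_ge0 // sqr_sqrtr //; lra.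
have : eta_bar Lf L3 p = 1 / (4 * Lf) \/
    eta_bar Lf L3 p = p `^ (2 / 3) / (36 `^ (1 / 3) * (Lf * L3) `^ (1 / 3)) \/
    eta_bar Lf L3 p = Num.sqrt p / Num.sqrt (6 * L3).
  have min_or (u v : R) : Num.min u v = u \/ Num.min u v = v by case: leP; auto.
  rewrite /eta_bar; set u := 1 / (4 * Lf); set v := (X in Num.min u X).
  by case: (min_or u v) => ->; [left | right; exact: min_or].
case=> [->|[->|->]]; rewrite invf_div.
- by rewrite divr1; lra.
- rewrite -mulrA -/b.
  have := ler_wpM2r b0 root36; lra.
- rewrite sqrtrM // -mulrA -sqrtrV ?ltW // -sqrtrM ?ltW // -/c.
  have := ler_wpM2r c0 root6; lra.
Qed.

(** * Convergence of L-SVRG *)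

Theorem corollary1 (R : realType) :
  exists c : R, 0 < c /\
  forall (d n : nat) (f : 'I_n -> 'cV[R]_d -> R) (xstar : 'cV[R]_d)
    (s : sampling R n) (Lf L3 p eta : R) (x0 : 'cV[R]_d)
    (dT : measure_display) (T : measurableType dT) (P : probability T R)
    (S : nat -> T -> outcome s) (B : nat -> T -> bool)
    (k : nat) (a : T -> 'I_k.+1),
  (0 < n)%N ->
  (forall i x, differentiable (f i) x) ->
  (forall x, average f xstar <= average f x) ->
  valid_sampling s ->
  unbiased s ->
  0 < Lf -> smooth Lf (average f) ->
  0 < L3 -> variance_bound f s L3 ->
  0 < p <= 1 ->
  0 < eta ->
  lsvrg_randomness p P S B a ->
  let x (i : nat) (w : T) := (lsvrg f eta x0 (S^~ w) (B^~ w) i).1 in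
  let risk := 'E_P[(fun w => enorm (grad (average f) (x (a w) w)) ^+ 2)%R]%E in
  let gap := average f x0 - average f xstar in
  (eta <= eta_bar Lf L3 p ->
     (risk <= (4 / eta * (gap / k.+1%:R))%:E)%E)
  /\
  (eta = eta_bar Lf L3 p ->
     forall eps : R, 0 < eps ->
       c * ((Lf + (Lf * L3) `^ (1 / 3) / p `^ (2 / 3) + Num.sqrt (L3 / p))
            * (gap / eps)) <= k%:R ->
       (risk <= eps%:E)%E).
Proof.
(* 16 = 4 * 4: the factor 4 of the risk bound and that of [inv_eta_bar_le]. *)
exists 16; split=> // d n f xstar s Lf L3 p eta x0 dT T P S B k a.
move=> _ df fmin _ unb L0 sm L30 var p01 eta0 [pS pB pa ind] x risk gap.
have /andP[p0 p1] := p01.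
have gap0 : 0 <= gap by rewrite subr_ge0.
have bound : eta <= eta_bar Lf L3 p ->
    (risk <= (4 / eta * (gap / k.+1%:R))%:E)%E.
  move=> /(eta_bar_bounds L0 L30 p0 eta0)[h1 h2 h3].
  pose coin (b : bool) := if b then p else 1 - p.
  pose K := mean_step (lsvrg_step f s eta) (@outcome_law R n s) coin.
  pose N (xw : 'cV[R]_d * 'cV[R]_d) := enorm (grad (average f) xw.1) ^+ 2.
  have N0 xw : 0 <= N xw by exact: sqr_ge0.
  have mS j u : measurable (S j @^-1` [set u]) by have [] := pS j u.
  have mB j b : measurable (B j @^-1` [set b]) by have [] := pB j b.
  have ma i : measurable (a @^-1` [set i]) by have [] := pa i.
  have riskE : risk = (k.+1%:R^-1 * \sum_(i < k.+1) iter i K N (x0, x0))%:E.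
    pose F (i : 'I_k.+1) w :=
      N (chain (lsvrg_step f s eta) (x0, x0) (S^~ w) (B^~ w) i).
    have -> : risk = (\int[P]_w (F (a w) w)%:E)%E.
      rewrite /risk unlock; apply: eq_integral => w _.
      by rewrite /F /N /x lsvrg_chain.
    rewrite (ge0_integral_fiber setT a F) //.
    - rewrite mulr_sumr -sumEFin; apply: eq_bigr => i _.
      have E : setT `&` a @^-1` [set i] =
          \bigcap_(j in [set` [:: None : option (nat + nat)]]) a @^-1` [set i].
        by rewrite bigcap_seq big_seq1 setTI.
      rewrite E (integral_chain _ (x0, x0) _ _ S B a pS pB ind i N [:: None]
        (fun _ => a @^-1` [set i])) //.
      + by rewrite big_seq1 (pa i).2 mulrC.
      + by move=> j; rewrite inE => /eqP ->; exact: sigma_of_preimage.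
      + by rewrite -E setTI.
    - by move=> i; exact: measurable_chain.
    - by move=> i w; exact: N0.
  rewrite riskE lee_fin.
  pose Psi := lyapunov f (lyap_weight Lf L3 p eta).
  have dec xw : K Psi xw <= Psi xw - eta / 4 * N xw.
    apply: lyapunov_decrease => //; first exact: (has_pmf_ge0 (pS 0%N)).
    exact: (has_pmf_sum (pS 0%N)).
  have PsiM xw : average f xstar <= Psi xw.
    apply: le_trans (fmin xw.1) _; rewrite lerDl mulr_ge0 ?dot_ge0 //.
    by rewrite divr_ge0 ?mulr_ge0 ?sqr_ge0 // ltW.
  have Psi0 : Psi (x0, x0) = average f x0.
    by rewrite /Psi /lyapunov /= subrr -(scale0r 0) dotZl mul0r mulr0 addr0.
  have := lyapunov_sum _ _ _ Psi N (eta / 4) _ (x0, x0) k.+1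
    (has_pmf_ge0 (pS 0%N)) (has_pmf_ge0 (pB 0%N))
    (has_pmf_sum (pS 0%N)) (has_pmf_sum (pB 0%N)) dec PsiM.
  rewrite Psi0 -/gap -/K => sum_le.
  rewrite [leRHS]mulrA [leRHS]mulrC ler_wpM2l ?invr_ge0 //.
  by rewrite -invf_div ler_pdivlMl // divr_gt0.
split=> // etaE eps eps0 kge.
apply: (le_trans (bound _)); first by rewrite etaE.
rewrite lee_fin.
have k1 : 0 < k.+1%:R :> R by [].
rewrite mulrA ler_pdivrMr // -ler_pdivrMl //.
have ge0 : 0 <= gap / eps by rewrite divr_ge0 // ltW.
have := ler_wpM2r ge0 (inv_eta_bar_le L0 L30 p0); rewrite -etaE => inv_le.
have -> : eps^-1 * (4 / eta * gap) = 4 * (eta^-1 * (gap / eps)).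
  by field; rewrite !gt_eqF.
by move: kge; rewrite -natr1; lra.
Qed.
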